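(* Let $B$ be a right-symmetric algebra with center $Z=Z(B)$ such that $Z$ contains no zero divisors of $B$, and let $F=Z^{-1}Z$. Suppose that $B$ is a central order in one of the following algebras, i.e. that $Z^{-1}B$ is isomorphic as an $F$-algebra to one of the following: (i) the matrix RS-algebra $F^n+M_n(F)$ for some integer $n\ge 2$; (ii) an algebra $\mathcal{A}=V_2+M_2(F)$ determined by a bilinear operation $\bullet$ on $V_2$ and a matrix $C\in M_2(F)$ as defined in the context, where the subspaces $F(1,0)$ and $F(0,1)$ of $V_2$ are not closed under the operation $\bullet$. Then $B$ embeds, as a $Z(B)$-module, in a finitely generated $Z(B)$-module.
   Context: Algebras are not assumed associative. Put $(x,y,z)=(xy)z-x(yz)$ and $[x,y]=xy-yx$. An algebra $A$ is right-symmetric if $(x,y,z)=(x,z,y)$ for all $x,y,z\in A$. Center: $Z(A)=\{z\in A\mid (z,x,y)=(x,z,y)=(x,y,z)=[x,z]=0\ \ \forall x,y\in A\}$. Central order: let $A$ be an algebra whose center $Z=Z(A)$ contains no zero divisors of the entire algebra $A$. Let $Z^{-1}A$ be the set of classes $\frac{a}{z}$ of pairs $(a,z)$, $a\in A$, $0\ne z\in Z$, under $(a,x)\sim(b,y)\iff ay=bx$, with addition and multiplication defined as for ordinary fractions. It is an algebra over the field of fractions $Z^{-1}Z$ and contains $A$ as a subalgebra. Then $A$ is called a central order in $Z^{-1}A$. Matrix RS-algebra: let $F$ be a field and $F^n$ the direct sum of $n$ copies of $F$ (an algebra with componentwise multiplication), with basis $e_1,\dots,e_n$, where $e_i$ has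 $1$ in the $i$-th place and $0$ elsewhere. Let $v\mapsto\overline{v}$ be the linear map $F^n\to M_n(F)$ with $\overline{e_i}=e_{ii}$ (matrix unit). The matrix RS-algebra is the direct sum of vector spaces $F^n+M_n(F)$ in which $F^n$ and $M_n(F)$ are subalgebras with their usual multiplications and, for $v\in F^n$, $A\in M_n(F)$, $$v\cdot A=vA,\qquad A\cdot v=vA+[A,\overline{v}],$$ where $vA\in F^n$ is the product of the row $v$ by the matrix $A$ and $[A,\overline{v}]\in M_n(F)$ is the matrix commutator. The algebra $\mathcal{A}=V_2+M_2(F)$: let $V_2$ be the space of rows of length 2 over $F$, equipped with a bilinear operation $\bullet: V_2\times V_2\to V_2$, and let $C\in M_2(F)$. Define $\pi:V_2\to M_2(F)$ by $\pi(x,y)=\begin{pmatrix} x & y \\ x & y \end{pmatrix}$ and $\psi_C(v)=\pi(v)\odot C$, where $\odot$ is the Hadamard (entrywise) product. On the direct sum of spaces $V_2+M_2(F)$ multiplication is defined as follows: $M_2(F)$ is a subalgebra with the usual matrix multiplication; for $v\in V_2$, $A\in M_2(F)$, $vA\in V_2$ is the product of the row $v$ by the matrix $A$; and $$Av=vA+[A,[R^{\bullet}_v]],\qquad wu=w\bullet u+\psi_C(u)\pi(w)$$ for all $v,w,u\in V_2$, $A\in M_2(F)$. Here $R^\bullet_v: x\mapsto x\bullet v$, and $[\varphi]$ is the matrix of a linear transformation $\varphi$ of $V_2$ in the basis $(1,0),(0,1)$, acting on rows from the right (so $x\bullet v=x[R^\bullet_v]$; the rows of $[R^\bullet_v]$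 are $(1,0)\bullet v$ and $(0,1)\bullet v$). A subspace $U\subseteq V_2$ is closed under $\bullet$ if $u\bullet u'\in U$ for all $u,u'\in U$; the hypothesis in (ii) says that neither $F(1,0)$ nor $F(0,1)$ is closed. *)

(* Defs.v *)
(* boolp only supplies classical logic, so that the center, a Prop-defined
   subset, can be handled as a boolean predicate. *)
From HB Require Import structures.
From mathcomp Require Import all_boot all_order all_algebra sesquilinear.
From mathcomp Require Import generic_quotient boolp ring.

Set Implicit Arguments.
Unset Strict Implicit.
Unset Printing Implicit Defensive.

Import GRing.Theory.
Local Open Scope ring_scope.

Reserved Notation "x ** y" (at level 40, left associativity).

(* An algebra over k: a k-module with a bilinear product.  Neither
   associativity nor a unit element is assumed. *)
HB.mixin Record Lmodule_isNAAlgebra (k : comNzRingType) V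
    of GRing.Lmodule k V := {
  namul : V -> V -> V;
  namul_linearl : forall y, linear (namul^~ y);
  namul_linearr : forall x, linear (namul x)
}.

#[short(type="naAlgType")]
HB.structure Definition NAAlgebra (k : comNzRingType) :=
  { V of GRing.Lmodule k V & Lmodule_isNAAlgebra k V }.

Notation "x ** y" := (namul x y) : ring_scope.

Section Notions.
Variables (k : comNzRingType) (B : naAlgType k).

Definition associator (x y z : B) : B := (x ** y) ** z - x ** (y ** z).

Definition commutator (x y : B) : B := x ** y - y ** x.

Definition right_symmetric : Prop :=
  forall x y z, associator x y z = associator x z y.

Definition central (z : B) : Prop :=
  forall x y, [/\ associator z x y = 0, associator x z y = 0,
                  associator x y z = 0 & commutator x z = 0].

Definition center : {pred B} := fun z => `[< central z >].

Definition zero_divisor (a : B) : Prop :=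
  a != 0 /\ exists2 b, b != 0 & a ** b = 0 \/ b ** a = 0.

(* The first clause says that there are denominators at all: without it
   Z^-1 B is empty and Z^-1 Z is not a field. *)
Definition regular_center : Prop :=
  (exists2 z, z \in center & z != 0)
  /\ (forall z, z \in center -> ~ zero_divisor z).

End Notions.

Arguments center {k} B.
Arguments right_symmetric {k} B.
Arguments regular_center {k} B.

Definition naalg_isom (k : comNzRingType) (A B : naAlgType k) : Prop :=
  exists f : {linear A -> B}, bijective f /\ {morph f : x y / x ** y}.

Section ProductTheory.
Variables (k : comNzRingType) (B : naAlgType k).
Implicit Types (x y z w : B) (c : k).

Lemma namulDl x y z : (x + y) ** z = x ** z + y ** z.
Proof. by have := namul_linearl z 1 x y; rewrite /= !scale1r. Qed.

Lemma namulDr x y z : x ** (y + z) = x ** y + x ** z.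
Proof. by have := namul_linearr x 1 y z; rewrite !scale1r. Qed.

Lemma na0mul x : 0 ** x = 0.
Proof. by apply: (@addrI _ (0 ** x)); rewrite -namulDl !addr0. Qed.

Lemma namul0 x : x ** 0 = 0.
Proof. by apply: (@addrI _ (x ** 0)); rewrite -namulDr !addr0. Qed.

Lemma namulNl x y : (- x) ** y = - (x ** y).
Proof. by apply/eqP; rewrite -addr_eq0 -namulDl addNr na0mul. Qed.

Lemma namulNr x y : x ** (- y) = - (x ** y).
Proof. by apply/eqP; rewrite -addr_eq0 -namulDr addNr namul0. Qed.

Lemma namulZl c x y : (c *: x) ** y = c *: (x ** y).
Proof.
by have := namul_linearl y c x 0; rewrite /= na0mul !addr0.
Qed.

Lemma namulZr c x y : x ** (c *: y) = c *: (x ** y).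
Proof. by have := namul_linearr x c y 0; rewrite namul0 !addr0. Qed.

Lemma centerP z :
  reflect [/\ forall x, x ** z = z ** x,
              forall x y, (z ** x) ** y = z ** (x ** y)
            & forall x y, x ** (z ** y) = z ** (x ** y)]
          (z \in center B).
Proof.
apply: (iffP (asboolP _)) => [cz|[zC zAl zCA] x y].
  have zC x : x ** z = z ** x.
    by case: (cz x x) => _ _ _ /eqP; rewrite subr_eq0 => /eqP.
  have zAl x y : (z ** x) ** y = z ** (x ** y).
    by case: (cz x y) => /eqP; rewrite subr_eq0 => /eqP.
  split=> // x y; case: (cz x y) => _ /eqP; rewrite subr_eq0 => /eqP <- _ _.
  by rewrite zC zAl.
by split; rewrite /associator /commutator ?zC ?zAl ?zCA ?zC ?subrr.
Qed.

Section Central.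
Variables (z : B) (Zz : z \in center B).
Lemma centralC x : x ** z = z ** x. Proof. by case/centerP: Zz. Qed.
Lemma centralA x y : (z ** x) ** y = z ** (x ** y).
Proof. by case/centerP: Zz. Qed.
Lemma centralCA x y : x ** (z ** y) = z ** (x ** y).
Proof. by case/centerP: Zz. Qed.
End Central.

Lemma center0 : 0 \in center B.
Proof. by apply/centerP; split=> *; rewrite ?(na0mul, namul0). Qed.

Lemma center_submod : submod_closed (center B).
Proof.
split=> [|c x y Zx Zy]; first exact: center0.
apply/centerP; split=> [u|u v|u v].
- by rewrite namulDl namulDr namulZl namulZr (centralC Zx) (centralC Zy).
- by rewrite !namulDl !namulZl (centralA Zx) (centralA Zy).
- by rewrite !namulDl namulDr !namulZl namulZr (centralCA Zx) (centralCA Zy).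
Qed.

HB.instance Definition _ :=
  GRing.isSubmodClosed.Build k B (center B) center_submod.

Lemma centerM x y : x \in center B -> y \in center B -> x ** y \in center B.
Proof.
move=> Zx Zy; apply/centerP; split=> [u|u v|u v].
- by rewrite (centralCA Zx) (centralC Zy) (centralA Zx).
- by rewrite !(centralA Zx) (centralA Zy).
- by rewrite !(centralA Zx) (centralCA Zx) (centralCA Zy).
Qed.

End ProductTheory.

Section CenterType.
Variables (k : comNzRingType) (B : naAlgType k).

Record center_type :=
  CenterType { center_val :> B; _ : center_val \in center B }.

HB.instance Definition _ := [isSub for center_val].
HB.instance Definition _ := [Choice of center_type by <:].
HB.instance Definition _ := [SubChoice_isSubLmodule of center_type by <:].

Lemma center_valP (z : center_type) : center_val z \in center B.
Proof. by case: z. Qed.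

Definition center_mul (z w : center_type) : center_type :=
  CenterType (centerM (center_valP z) (center_valP w)).

Fact center_mul_linearl w : linear (center_mul^~ w).
Proof.
by move=> c x y; apply: val_inj; rewrite /= !(namulDl, namulZl).
Qed.

Fact center_mul_linearr z : linear (center_mul z).
Proof.
by move=> c x y; apply: val_inj; rewrite /= !(namulDr, namulZr).
Qed.

HB.instance Definition _ := Lmodule_isNAAlgebra.Build k center_type
  center_mul_linearl center_mul_linearr.

End CenterType.

Arguments center_type {k} B.

Section CenterModules.
Variables (k : comNzRingType) (B : naAlgType k) (M : lmodType k).
Variable act : {bilinear center_type B -> M -> M}.

(* Z(B) need not contain an identity; when it does, modules are unital.  As
   Z(B) is a k-algebra, its modules are k-modules with a k-bilinear action. *)
Definition center_module : Prop :=
  (forall z w m, act (z ** w) m = act z (act w m))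
  /\ (forall e, (forall z : center_type B, e ** z = z) ->
      forall m, act e m = m).

Definition center_submodule (N : M -> Prop) : Prop :=
  [/\ N 0, forall c m m', N m -> N m' -> N (c *: m + m')
         & forall z m, N m -> N (act z m)].

(* M is the least submodule containing some finite family; this is the correct
   notion also when Z(B) has no identity. *)
Definition finitely_generated : Prop :=
  exists s : seq M, forall N, center_submodule N ->
    (forall m, m \in s -> N m) -> forall m, N m.

End CenterModules.

Definition embeds_in_fg_center_module (k : comNzRingType) (B : naAlgType k) :
    Prop :=
  exists (M : lmodType k) (act : {bilinear center_type B -> M -> M}),
    [/\ center_module act, finitely_generated act
      & exists f : {linear B -> M}, injective f /\
          forall (z : center_type B) b, f (center_val z ** b) = act z (f b)].

Section Fractions.
Variables (k : comNzRingType) (B : naAlgType k) (hZ : regular_center B).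
Local Notation Z := (center B).

Record denominator :=
  Denominator { den_val :> B; _ : (den_val \in Z) && (den_val != 0) }.

HB.instance Definition _ := [isSub for den_val].
HB.instance Definition _ := [Choice of denominator by <:].

Lemma denZ (x : denominator) : (x : B) \in Z.
Proof. by case: x => x /= /andP[]. Qed.

Lemma den_neq0 (x : denominator) : (x : B) != 0.
Proof. by case: x => x /= /andP[]. Qed.

Lemma den_inj (x : denominator) : injective (namul (x : B)).
Proof.
move=> a b /eqP; rewrite -subr_eq0 -namulNr -namulDr => /eqP xab.
apply/eqP; rewrite -subr_eq0; apply/negPn/negP => ab0.
case: hZ => _ /(_ _ (denZ x)); apply; split; first exact: den_neq0.
by exists (a - b); last by left.
Qed.

Lemma den_mul_subproof (x y : denominator) :
  (x ** y \in Z) && ((x : B) ** y != 0).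
Proof.
rewrite centerM ?denZ //=; apply/eqP.
rewrite -(namul0 (x : B)) => /den_inj y0.
by have := den_neq0 y; rewrite y0 eqxx.
Qed.

Definition den_mul x y : denominator := Denominator (den_mul_subproof x y).

Lemma den1_subproof : exists z : B, (z \in Z) && (z != 0).
Proof. by case: hZ => -[z Zz z0] _; exists z; rewrite Zz. Qed.

(* an arbitrary denominator, needed to write 0 = 0/z and 1 = z/z *)
Fact den1 : denominator.
Proof. exact: Denominator (xchooseP den1_subproof). Qed.

Lemma denC (x : denominator) (a : B) : a ** x = x ** a.
Proof. exact: centralC (denZ x) a. Qed.

Lemma denA (x : denominator) (a b : B) : (x ** a) ** b = x ** (a ** b).
Proof. exact: centralA (denZ x) a b. Qed.

Lemma denCA (x : denominator) (a b : B) : a ** (x ** b) = x ** (a ** b).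
Proof. exact: centralCA (denZ x) a b. Qed.

Lemma denACA (x y : denominator) (a b : B) :
  (x ** a) ** (y ** b) = (x ** y) ** (a ** b).
Proof. by rewrite !denA denCA. Qed.

(* (a, x) ~ (b, y) iff a y = b x *)
Definition frac_eq (p q : B * denominator) : bool :=
  p.1 ** q.2 == q.1 ** p.2.

Fact frac_eq_refl : reflexive frac_eq. Proof. by move=> p; apply/eqP. Qed.

Fact frac_eq_sym : symmetric frac_eq.
Proof. by move=> p q; rewrite /frac_eq eq_sym. Qed.

Fact frac_eq_trans : transitive frac_eq.
Proof.
move=> [b y] [a x] [c z]; rewrite /frac_eq /= !denC.
move=> /eqP ayx /eqP bzy.
apply/eqP/(den_inj (x := y)).
by rewrite (denCA z) ayx (denCA x) bzy (denCA y).
Qed.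

Canonical frac_equiv := EquivRel frac_eq frac_eq_refl frac_eq_sym frac_eq_trans.

(* Z^-1 B *)
Definition central_fractions := {eq_quot frac_eq}%qT.

HB.instance Definition _ := EqQuotient.on central_fractions.
HB.instance Definition _ := Choice.on central_fractions.

Implicit Types (q r s : central_fractions) (a b c : B) (x y z : denominator).

Definition cfrac (a : B) (x : denominator) : central_fractions :=
  \pi_central_fractions%qT (a, x).

Definition num q : B := (repr q).1.
Definition den q : denominator := (repr q).2.

Lemma fracK q : cfrac (num q) (den q) = q.
Proof. by rewrite /cfrac -surjective_pairing reprK. Qed.

Lemma frac_eqP a x b y : cfrac a x = cfrac b y <-> y ** a = x ** b.
Proof.
rewrite -(denC y) -(denC x).
by split=> [/eqmodP/eqP//|e]; apply/eqmodP/eqP.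
Qed.

Lemma fracE a x : den (cfrac a x) ** a = x ** num (cfrac a x).
Proof. by apply/frac_eqP; rewrite fracK. Qed.

Lemma fracP q : exists a x, q = cfrac a x.
Proof. by exists (num q), (den q); rewrite fracK. Qed.

(* For the central den r, num q ** den r is written den r ** num q. *)
Definition frac_add q r :=
  cfrac (den r ** num q + den q ** num r) (den_mul (den q) (den r)).
Definition frac_opp q := cfrac (- num q) (den q).
Definition frac_mul q r := cfrac (num q ** num r) (den_mul (den q) (den r)).

Lemma frac_addE a x b y :
  frac_add (cfrac a x) (cfrac b y) = cfrac (y ** a + x ** b) (den_mul x y).
Proof.
apply/frac_eqP; rewrite /= !namulDr !denA.
set x' := den (cfrac a x); set y' := den (cfrac b y).
congr (_ + _).
  rewrite (denCA y x) (denCA y' x) -fracE.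
  by rewrite (denCA y y') (denCA y x') (denCA y' x').
by rewrite (denCA x' y) -fracE (denCA x y') (denCA x' x).
Qed.

Lemma frac_oppE a x : frac_opp (cfrac a x) = cfrac (- a) x.
Proof. by apply/frac_eqP; rewrite !namulNr fracE. Qed.

Lemma frac_mulE a x b y :
  frac_mul (cfrac a x) (cfrac b y) = cfrac (a ** b) (den_mul x y).
Proof. by apply/frac_eqP; rewrite /= -!denACA !fracE. Qed.

Fact frac_addA : associative frac_add.
Proof.
move=> q r s; have [a [x ->]] := fracP q; have [b [y ->]] := fracP r.
have [c [z ->]] := fracP s; rewrite !frac_addE.
apply/frac_eqP; rewrite /= !denA !namulDr -!addrA.
by rewrite (denCA y z a) (denCA x z b).
Qed.

Fact frac_addC : commutative frac_add.
Proof.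
move=> q r; have [a [x ->]] := fracP q; have [b [y ->]] := fracP r.
by rewrite !frac_addE addrC; apply/frac_eqP; rewrite /= (denC x y).
Qed.

Fact frac_add0 : left_id (cfrac 0 den1) frac_add.
Proof.
move=> q; have [a [x ->]] := fracP q; rewrite frac_addE.
by apply/frac_eqP; rewrite /= namul0 add0r denA denCA.
Qed.

Fact frac_addN : left_inverse (cfrac 0 den1) frac_opp frac_add.
Proof.
move=> q; have [a [x ->]] := fracP q; rewrite frac_oppE frac_addE.
by apply/frac_eqP; rewrite /= namulNr addNr !namul0.
Qed.

HB.instance Definition _ := GRing.isZmodule.Build central_fractions
  frac_addA frac_addC frac_add0 frac_addN.

Lemma frac_addrE a x b y :
  cfrac a x + cfrac b y = cfrac (y ** a + x ** b) (den_mul x y).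
Proof. exact: frac_addE. Qed.

Lemma frac_oprE a x : - cfrac a x = cfrac (- a) x.
Proof. exact: frac_oppE. Qed.

Lemma frac0E x : cfrac 0 x = 0.
Proof. by apply/frac_eqP; rewrite !namul0. Qed.

Fact frac_mulDl : left_distributive frac_mul +%R.
Proof.
move=> q r s; have [a [x ->]] := fracP q; have [b [y ->]] := fracP r.
have [c [z ->]] := fracP s; rewrite !(frac_addrE, frac_mulE).
apply/frac_eqP; rewrite /= namulDl !denA (denCA y z).
by rewrite [in LHS]namulDr (denCA y z) (denCA x z).
Qed.

Fact frac_mulDr : right_distributive frac_mul +%R.
Proof.
move=> s q r; have [a [x ->]] := fracP q; have [b [y ->]] := fracP r.
have [c [z ->]] := fracP s; rewrite !(frac_addrE, frac_mulE).
apply/frac_eqP; rewrite /= namulDr !denA (denCA y z) (denCA y c) (denCA x c).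
by rewrite [in LHS]namulDr (denCA y z) (denCA x z).
Qed.

(* Z^-1 Z as a subset of Z^-1 B *)
Definition center_fractions : {pred central_fractions} :=
  fun q => `[< exists a x, a \in Z /\ q = cfrac a x >].

Lemma center_fractionsP q :
  reflect (exists a x, a \in Z /\ q = cfrac a x) (q \in center_fractions).
Proof. exact: asboolP. Qed.

Lemma num_center q : q \in center_fractions -> num q \in Z.
Proof.
case/center_fractionsP=> a [x [Za ->]].
have Zxa : x ** num (cfrac a x) \in Z by rewrite -fracE centerM ?denZ.
set a' := num _ in Zxa *.
apply/centerP; split=> [u|u v|u v]; apply: (den_inj (x := x)).
- by rewrite -denCA (centralC Zxa) denA.
- by rewrite -denA -denA (centralA Zxa) denA.
- by rewrite -denCA -(denA x a' v) (centralCA Zxa) denA.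
Qed.

Fact center_fractions_zmod : zmod_closed center_fractions.
Proof.
split=> [|q r].
  by apply/center_fractionsP; exists 0, den1; rewrite center0.
case/center_fractionsP=> a [x [Za ->]] /center_fractionsP[b [y [Zb ->]]].
apply/center_fractionsP; rewrite frac_oprE frac_addrE; do 2!eexists; split=> //.
by rewrite namulNr rpredB ?centerM ?denZ.
Qed.

HB.instance Definition _ := GRing.isZmodClosed.Build central_fractions
  center_fractions center_fractions_zmod.

Lemma center_fractionsM q r : q \in center_fractions ->
  r \in center_fractions -> frac_mul q r \in center_fractions.
Proof.
case/center_fractionsP=> a [x [Za ->]] /center_fractionsP[b [y [Zb ->]]].
apply/center_fractionsP; rewrite frac_mulE; do 2!eexists; split=> //.
exact: centerM.
Qed.

Section CentralMul.
Variable (q : central_fractions) (Fq : q \in center_fractions).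

Lemma frac_mulC r : frac_mul r q = frac_mul q r.
Proof.
have [a [x [Za ->]]] := center_fractionsP _ Fq.
have [b [y ->]] := fracP r.
by rewrite !frac_mulE; apply/frac_eqP; rewrite /= (denC x y) (centralC Za).
Qed.

Lemma frac_mulA r s : frac_mul (frac_mul q r) s = frac_mul q (frac_mul r s).
Proof.
have [a [x [Za ->]]] := center_fractionsP _ Fq.
have [b [y ->]] := fracP r; have [c [z ->]] := fracP s.
by rewrite !frac_mulE; apply/frac_eqP; rewrite /= !denA (centralA Za).
Qed.

Lemma frac_mulCA r s : frac_mul r (frac_mul q s) = frac_mul q (frac_mul r s).
Proof.
have [a [x [Za ->]]] := center_fractionsP _ Fq.
have [b [y ->]] := fracP r; have [c [z ->]] := fracP s.
rewrite !frac_mulE; apply/frac_eqP; rewrite /= !denA (centralCA Za).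
by rewrite (denCA x y).
Qed.
End CentralMul.

Lemma frac_mul1 x q : frac_mul (cfrac x x) q = q.
Proof.
have [a [y ->]] := fracP q; rewrite frac_mulE.
by apply/frac_eqP; rewrite /= denA denCA.
Qed.

(* Z^-1 Z *)
Record center_field :=
  CenterField { cf_val :> central_fractions; _ : cf_val \in center_fractions }.

HB.instance Definition _ := [isSub for cf_val].
HB.instance Definition _ := [Choice of center_field by <:].
HB.instance Definition _ := [SubChoice_isSubZmodule of center_field by <:].

Lemma cf_valP (f : center_field) : cf_val f \in center_fractions.
Proof. by case: f. Qed.

Definition cf_mul (f g : center_field) : center_field :=
  CenterField (center_fractionsM (cf_valP f) (cf_valP g)).

Lemma center_frac_subproof a x : a \in Z -> cfrac a x \in center_fractions.
Proof. by move=> Za; apply/center_fractionsP; exists a, x. Qed.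

Definition cf_one : center_field :=
  CenterField (center_frac_subproof den1 (denZ den1)).

(* the inverse of a/x is x/a *)
Definition cf_inv (f : center_field) : center_field :=
  if insub (num f) is Some y
  then CenterField (center_frac_subproof y (denZ (den f))) else 0.

Fact cf_mulA : associative cf_mul.
Proof. by move=> f g h; apply: val_inj; rewrite /= frac_mulA ?cf_valP. Qed.

Fact cf_mulC : commutative cf_mul.
Proof. by move=> f g; apply: val_inj; rewrite /= frac_mulC ?cf_valP. Qed.

Fact cf_mul1 : left_id cf_one cf_mul.
Proof. by move=> f; apply: val_inj; rewrite /= frac_mul1. Qed.

Fact cf_mulDl : left_distributive cf_mul +%R.
Proof. by move=> f g h; apply: val_inj; rewrite /= frac_mulDl. Qed.

Fact cf_one_neq0 : cf_one != 0.
Proof.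
apply/eqP => /(congr1 val) /=; rewrite -(frac0E den1) => /frac_eqP/den_inj d0.
by have := den_neq0 den1; rewrite d0 eqxx.
Qed.

HB.instance Definition _ := GRing.Zmodule_isComNzRing.Build center_field
  cf_mulA cf_mulC cf_mul1 cf_mulDl cf_one_neq0.

Fact cf_mulV (f : center_field) : f != 0 -> cf_mul (cf_inv f) f = 1.
Proof.
move=> f0; have Zn := num_center (cf_valP f).
have n0 : num f != 0.
  apply: contra_neq f0 => n0; apply: val_inj.
  by rewrite /= -(fracK f) n0 frac0E.
apply: val_inj => /=; rewrite /cf_inv; case: insubP => [y _ /= yE|]; last first.
  by rewrite Zn n0.
have fE : cf_val f = cfrac y (den f) by rewrite yE fracK.
rewrite [X in frac_mul _ X]fE frac_mulE; apply/frac_eqP => /=.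
by rewrite (denC y (den f)) [RHS]denC.
Qed.

Fact cf_inv0 : cf_inv 0 = 0.
Proof.
have n0 : num (cf_val 0) = 0.
  have /frac_eqP : cfrac (num (cf_val 0)) (den (cf_val 0)) = cfrac 0 den1.
    by rewrite fracK.
  by rewrite namul0 => e; apply: (den_inj (x := den1)); rewrite namul0.
by rewrite /cf_inv n0 insubF // eqxx andbF.
Qed.

HB.instance Definition _ :=
  GRing.ComNzRing_isField.Build center_field cf_mulV cf_inv0.

Definition cf_scale (f : center_field) q : central_fractions := frac_mul f q.

Fact cf_scaleA f g q : cf_scale f (cf_scale g q) = cf_scale (f * g) q.
Proof. by rewrite /cf_scale /= frac_mulA ?cf_valP. Qed.

Fact cf_scale1 : left_id 1 cf_scale.
Proof. by move=> q; rewrite /cf_scale /= frac_mul1. Qed.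

Fact cf_scaleDr : right_distributive cf_scale +%R.
Proof. by move=> f q r; rewrite /cf_scale frac_mulDr. Qed.

Fact cf_scaleDl q : {morph cf_scale^~ q : f g / f + g}.
Proof. by move=> f g; rewrite /cf_scale /= frac_mulDl. Qed.

HB.instance Definition _ := GRing.Zmodule_isLmodule.Build center_field
  central_fractions cf_scaleA cf_scale1 cf_scaleDr cf_scaleDl.

Fact frac_mul_linearl r : linear (frac_mul^~ r).
Proof.
by move=> f p q; rewrite frac_mulDl [in LHS]/GRing.scale /= frac_mulA ?cf_valP.
Qed.

Fact frac_mul_linearr r : linear (frac_mul r).
Proof.
by move=> f p q; rewrite frac_mulDr [in LHS]/GRing.scale /= frac_mulCA ?cf_valP.
Qed.

HB.instance Definition _ := Lmodule_isNAAlgebra.Build center_field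
  central_fractions frac_mul_linearl frac_mul_linearr.

End Fractions.

Arguments central_fractions {k B} hZ.
Arguments center_field {k B} hZ.

(* B is a central order in an algebra isomorphic to A *)
Definition central_order_in (k : comNzRingType) (B : naAlgType k)
    (hZ : regular_center B) (A : naAlgType (center_field hZ)) : Prop :=
  naalg_isom (central_fractions hZ) A.

Arguments central_order_in {k B} hZ A.

Fact addr_lincomb (F : fieldType) (V : lmodType F) (c : F) (u u' w w' : V) :
  c *: u + u' + (c *: w + w') = c *: (u + w) + (u' + w').
Proof. by rewrite scalerDr addrACA. Qed.

Definition mx_commutator (F : fieldType) n (A B : 'M[F]_n) : 'M[F]_n :=
  A *m B - B *m A.

Arguments mx_commutator {F n} A B.

Fact mx_commutator_linearl (F : fieldType) n (B : 'M[F]_n) :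
  linear (mx_commutator^~ B).
Proof.
move=> c A A'; rewrite /mx_commutator mulmxDl mulmxDr -scalemxAl -scalemxAr.
by rewrite scalerBr opprD addrACA.
Qed.

Fact mx_commutator_linearr (F : fieldType) n (A : 'M[F]_n) :
  linear (mx_commutator A).
Proof.
move=> c B B'; rewrite /mx_commutator mulmxDl mulmxDr -scalemxAl -scalemxAr.
by rewrite scalerBr opprD addrACA.
Qed.

Section MatrixRS.
Variables (F : fieldType) (n : nat).

Definition matrixRS : Type := ('rV[F]_n * 'M[F]_n)%type.

HB.instance Definition _ := GRing.Lmodule.on matrixRS.

(* (v + A)(w + B), where v w is the componentwise product, v B is a row times
   a matrix and A w = w A + [A, diag w] *)
Definition matrixRS_mul (p q : matrixRS) : matrixRS :=
  let: (v, A) := p in let: (w, B) := q in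
  (map2_mx *%R v w + v *m B + w *m A,
   A *m B + mx_commutator A (diag_mx w)).

Fact matrixRS_mul_linearl q : linear (matrixRS_mul^~ q).
Proof.
case: q => w B c [v A] [v' A']; congr (_, _) => /=.
  apply/rowP=> i; rewrite mulmxDl mulmxDr -scalemxAl -scalemxAr !mxE; ring.
by rewrite mx_commutator_linearl mulmxDl -scalemxAl addr_lincomb.
Qed.

Fact matrixRS_mul_linearr p : linear (matrixRS_mul p).
Proof.
case: p => v A c [w B] [w' B']; congr (_, _) => /=.
  apply/rowP=> i; rewrite mulmxDl mulmxDr -scalemxAl -scalemxAr !mxE; ring.
rewrite (linearP (@diag_mx F n)) mx_commutator_linearr mulmxDr -scalemxAr.
by rewrite addr_lincomb.
Qed.

HB.instance Definition _ := Lmodule_isNAAlgebra.Build F matrixRS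
  matrixRS_mul_linearl matrixRS_mul_linearr.

End MatrixRS.

(* V_2 + M_2(F); the parameters are kept in the type to index the product. *)
Definition algebraVM (F : fieldType)
    (bul : {bilinear 'rV[F]_2 -> 'rV[F]_2 -> 'rV[F]_2}) (C : 'M[F]_2) : Type :=
  ('rV[F]_2 * 'M[F]_2)%type.

Arguments algebraVM {F} bul C.

Section AlgebraVM.
Variables (F : fieldType).
Variables (bul : {bilinear 'rV[F]_2 -> 'rV[F]_2 -> 'rV[F]_2}) (C : 'M[F]_2).
Local Notation V2 := 'rV[F]_2.

Definition row_pi (v : V2) : 'M[F]_2 := \matrix_(i, j) v 0 j.

Definition row_psi (v : V2) : 'M[F]_2 := map2_mx *%R (row_pi v) C.

(* the matrix of x |-> x bullet v acting on rows from the right: its i-th row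
   is e_i bullet v *)
Definition bullet_rmx (v : V2) : 'M[F]_2 := lin1_mx (bul^~ v).

Local Notation algVM := (algebraVM bul C).

HB.instance Definition _ := GRing.Lmodule.on algVM.

(* (v + A)(w + B), where v w = v bullet w + psi_C(w) pi(v)
   and A w = w A + [A, [R_w]] *)
Definition algebraVM_mul (p q : algVM) : algVM :=
  let: (v, A) := p in let: (w, B) := q in
  (bul v w + v *m B + w *m A,
   A *m B + mx_commutator A (bullet_rmx w) + row_psi w *m row_pi v).

Fact row_pi_linear : linear row_pi.
Proof. by move=> c v w; apply/matrixP=> i j; rewrite !mxE. Qed.

Fact row_psi_linear : linear row_psi.
Proof.
by move=> c v w; apply/matrixP=> i j; rewrite !mxE mulrDl mulrA.
Qed.

Fact bullet_rmx_linear : linear bullet_rmx.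
Proof.
by move=> c v w; apply/matrixP=> i j; rewrite !mxE linearPr !mxE.
Qed.

Fact algebraVM_mul_linearl q : linear (algebraVM_mul^~ q).
Proof.
case: q => w B c [v A] [v' A']; congr (_, _) => /=.
  by rewrite linearPl mulmxDl mulmxDr -scalemxAl -scalemxAr !addr_lincomb.
rewrite mx_commutator_linearl row_pi_linear mulmxDl mulmxDr.
by rewrite -scalemxAl -scalemxAr !addr_lincomb.
Qed.

Fact algebraVM_mul_linearr p : linear (algebraVM_mul p).
Proof.
case: p => v A c [w B] [w' B']; congr (_, _) => /=.
  by rewrite linearPr mulmxDl mulmxDr -scalemxAl -scalemxAr !addr_lincomb.
rewrite bullet_rmx_linear mx_commutator_linearr row_psi_linear mulmxDl mulmxDr.
by rewrite -scalemxAl -scalemxAr !addr_lincomb.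
Qed.

HB.instance Definition _ := Lmodule_isNAAlgebra.Build F algVM
  algebraVM_mul_linearl algebraVM_mul_linearr.

Definition bullet_closed (U : {vspace V2}) : Prop :=
  forall u u', u \in U -> u' \in U -> bul u u' \in U.

End AlgebraVM.

Arguments bullet_closed {F} bul U.

Definition coord_line (F : fieldType) (i : 'I_2) : {vspace 'rV[F]_2} :=
  <[delta_mx 0%R i]>%VS.

(* Main.v *)
(* Each of the two algebras A = Z^-1 B contains M_n(F) with the same identity,
   and the operators built from multiplications by matrix units whose values
   are scalar have no common kernel in A.  A common denominator turns these
   finitely many operators into Z-linear maps from B to Z with no common
   kernel, so B embeds in Z^N.

   The common kernel consists of the a = v + A such that A Q + R_(v Q) is
   scalar for all Q, where R_w is the matrix of right multiplication by w on V.
   If v <> 0, this forces R_w = l(w) - c w for some column c, so that each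
   coordinate line F e_i satisfies e_i e_i = (l(e_i) - c_i) e_i and is closed
   under the product; componentwise multiplication is excluded likewise. *)

Require Import Defs.
From HB Require Import structures.
From mathcomp Require Import all_boot all_order all_algebra sesquilinear.
From mathcomp Require Import generic_quotient boolp.

Set Implicit Arguments.
Unset Strict Implicit.
Unset Printing Implicit Defensive.

Import GRing.Theory.
Local Open Scope ring_scope.

(** * A finitely generated module over a center possibly without identity *)

Section SpanModule.
Variables (k : comNzRingType) (B : naAlgType k) (I : finType).
Variable z : center_type B.

(* The Z(B)-submodule of B^I generated by the vectors z e_i.  Z(B) may lack an
   identity, in which case Z(B)^I itself need not be finitely generated. *)
Definition span_pred : {pred {ffun I -> B}} :=
  fun m => `[< forall i, exists c (y : center_type B),
    m i = c *: (z : B) + (y : B) ** z >].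

Lemma span_predP (m : {ffun I -> B}) :
  reflect (forall i, exists c (y : center_type B),
             m i = c *: (z : B) + (y : B) ** z)
          (m \in span_pred).
Proof. exact: asboolP. Qed.

Fact span_submod : submod_closed span_pred.
Proof.
split=> [|a m m' /span_predP Sm /span_predP Sm']; apply/span_predP=> i.
  by exists 0, 0; rewrite ffunE scale0r na0mul addr0.
have [[c [y my]] [c' [y' my']]] := (Sm i, Sm' i).
exists (a * c + c'), (a *: y + y'); rewrite !ffunE my my' /= namulDl namulZl.
by rewrite scalerDl -scalerA scalerDr addrACA.
Qed.

HB.instance Definition _ :=
  GRing.isSubmodClosed.Build k {ffun I -> B} span_pred span_submod.

Record span_module := SpanModule
  { span_val :> {ffun I -> B}; _ : span_val \in span_pred }.

HB.instance Definition _ := [isSub for span_val].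
HB.instance Definition _ := [Choice of span_module by <:].
HB.instance Definition _ := [SubChoice_isSubLmodule of span_module by <:].

Fact span_act_subproof (x : center_type B) (m : span_module) :
  [ffun i => (x : B) ** m i] \in span_pred.
Proof.
case: m => m /= /span_predP Sm; apply/span_predP=> i; have [c [y my]] := Sm i.
(* Since [x] is central, x (c z + y z) = (c x + x y) z. *)
exists 0, (c *: x + x ** y).
rewrite ffunE my scale0r add0r namulDr namulZr /= namulDl namulZl.
by rewrite (centralA (center_valP x)).
Qed.

Definition span_act x m : span_module := SpanModule (span_act_subproof x m).

Fact span_act_bilinear : bilinear_for *:%R *:%R span_act.
Proof.
split=> [m c x y|x c m m']; apply: val_inj; apply/ffunP=> i; rewrite !ffunE /=.
  by rewrite namulDl namulZl.
by rewrite namulDr namulZr.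
Qed.

HB.instance Definition _ := bilinear_isBilinear.Build k (center_type B)
  span_module span_module *:%R *:%R span_act span_act_bilinear.

Lemma span_act_module : center_module span_act.
Proof.
split=> [x y m|e e1 m]; apply: val_inj; apply/ffunP=> i; rewrite !ffunE /=.
  by rewrite (centralA (center_valP x)).
have /span_predP/(_ i)[c [y ->]] := valP m.
have ez : (e : B) ** z = z by rewrite -[LHS]/(val (e ** z)) e1.
by rewrite namulDr namulZr ez (centralCA (center_valP y)) ez.
Qed.

Fact span_gen_subproof (i : I) :
  [ffun j => if j == i then z : B else 0] \in span_pred.
Proof.
apply/span_predP=> j; rewrite ffunE; case: ifP => _.
  by exists 1, 0; rewrite scale1r na0mul addr0.
by exists 0, 0; rewrite scale0r na0mul addr0.
Qed.

Definition span_gen i : span_module := SpanModule (span_gen_subproof i).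

Lemma span_module_fg : finitely_generated span_act.
Proof.
exists [seq span_gen i | i <- enum I] => N [N0 NP NA] Ngen m.
have /span_predP/choice[c /choice[y my]] := valP m.
have -> : m = \sum_i (c i *: span_gen i + span_act (y i) (span_gen i)).
  apply: val_inj; apply/ffunP=> j; rewrite raddf_sum /= sum_ffunE.
  rewrite (bigD1 j) //= big1 ?addr0 => [|i ij]; rewrite !ffunE ?eqxx //=.
  by rewrite eq_sym (negPf ij) scaler0 namul0 addr0.
have Ng i : N (span_gen i) by apply/Ngen/map_f; rewrite mem_enum.
elim/big_ind: _ => // [x x' Nx Nx'|i _].
  by rewrite -[x]scale1r; apply: NP.
by apply: NP => //; apply: NA.
Qed.

End SpanModule.

(** * Embeddings from center-linear maps into the center *)

Section Embedding.
Variables (k : comNzRingType) (B : naAlgType k) (hZ : regular_center B).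

(** The embedding is b |-> (z T_i(b))_i for a nonzero central z: the factor z moves the central
    values into the span of the z e_i, and no information is lost because z is not a zero
    divisor. *)
Lemma embeds_of_center_maps (I : finType) (T : I -> B -> B) :
    (forall i, linear (T i)) ->
    (forall i z b, z \in center B -> T i (z ** b) = z ** T i b) ->
    (forall i b, T i b \in center B) ->
    (forall b, (forall i, T i b = 0) -> b = 0) ->
  embeds_in_fg_center_module B.
Proof.
move=> Tlin TZ Tc T0; pose x := den1 hZ; pose z := CenterType (denZ x).
have fP b : [ffun i => (z : B) ** T i b] \in span_pred z.
  apply/span_predP=> i; exists 0, (CenterType (Tc i b)).
  by rewrite ffunE scale0r add0r (centralC (denZ x)).
pose f b := SpanModule (fP b).
have f_lin : linear f.
  move=> c a b; apply: val_inj; apply/ffunP=> i.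
  by rewrite /= !ffunE Tlin namulDr namulZr.
pose fL := HB.pack_for {linear B -> span_module I z} f
  (GRing.isLinear.Build k B (span_module I z) *:%R f f_lin).
exists (span_module I z), (@span_act k B I z).
split; [exact: span_act_module | exact: span_module_fg | exists fL].
split=> [|y b]; last first.
  apply: val_inj; apply/ffunP=> i; rewrite /= !ffunE TZ ?center_valP //.
  by rewrite (centralCA (center_valP y)).
apply: raddf_inj => b /(congr1 val)/ffunP fb0; apply: T0 => i.
apply: (den_inj hZ (x := x)); rewrite namul0.
by have := fb0 i; rewrite /= !ffunE.
Qed.

End Embedding.

(** * Identities for commutators and matrix units *)

Section Commutator.
Variables (F : fieldType) (n : nat).
Implicit Types X Y Z : 'M[F]_n.

Lemma mx_commutator0 X : mx_commutator X 0 = 0.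
Proof. by rewrite /mx_commutator mulmx0 mul0mx subrr. Qed.

Lemma mx_commutator1 X : mx_commutator 1%:M X = 0.
Proof. by rewrite /mx_commutator mulmx1 mul1mx subrr. Qed.

Lemma mx_commutatorDr X Y Z :
  mx_commutator X (Y + Z) = X *m Y + mx_commutator X Z - Y *m X.
Proof. by rewrite /mx_commutator mulmxDr mulmxDl opprD addrACA [RHS]addrAC. Qed.

End Commutator.

(** Each summand e_is Y e_ti equals Y_st e_ii. *)
Lemma sum_delta_sandwich (F : fieldType) n (Y : 'M[F]_n) (s t : 'I_n) :
  \sum_(i < n) delta_mx i s *m (Y *m delta_mx t i) = (Y s t)%:M.
Proof.
apply/matrixP=> i j; rewrite summxE (bigD1 i) //= big1 => [|l li].
  rewrite !mxE addr0 (bigD1 s) //= big1 => [|m ms]; last first.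
    by rewrite !mxE (negPf ms) andbF mul0r.
  rewrite !mxE !eqxx mul1r addr0 (bigD1 t) //= big1 => [|m mt].
    by rewrite !mxE eqxx addr0 eq_sym mulr_natr.
  by rewrite !mxE (negPf mt) mulr0.
by rewrite !mxE big1 // => m _; rewrite !mxE eq_sym (negPf li) mul0r.
Qed.

Lemma scalar_of_commutator0 (F : fieldType) n (Y : 'M[F]_n) :
  (forall p q, mx_commutator (delta_mx p q) Y = 0) -> exists a, Y = a%:M.
Proof.
move=> cY; case: n Y cY => [|n] Y cY; first by exists 0; rewrite !flatmx0.
exists (Y 0 0); apply/matrixP=> i j.
(* The (0,j) entry of [e_0i, Y] is Y_ij minus Y_00 when i = j, and Y_ij otherwise. *)
have /matrixP/(_ 0 j) := cY 0 i; rewrite /mx_commutator !mxE => /eqP.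
rewrite subr_eq0 (bigD1 i) //= big1 => [|m mi]; last first.
  by rewrite !mxE (negPf mi) andbF mul0r.
rewrite !mxE !eqxx mul1r addr0 (bigD1 0) //= big1 => [|m m0]; last first.
  by rewrite !mxE (negPf m0) mulr0.
by rewrite !mxE eqxx addr0 mulr_natr (eq_sym i) => /eqP.
Qed.

(* iota embeds M_n(F) in A, and commutators with iota X only depend on tau a.
   For V + M_n(F), where A v = v A + [A, R_v], one takes
   tau (v + A) = A + R_v. *)
Definition matrix_controlled (F : fieldType) n (A : naAlgType F) : Prop :=
  exists (iota : {linear 'M[F]_n -> A}) (tau : {linear A -> 'M[F]_n}),
  [/\ {morph iota : X Y / X *m Y >-> X ** Y},
      forall a, iota 1%:M ** a = a,
      forall a, a ** iota 1%:M = a,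
      forall X a, commutator (iota X) a = iota (mx_commutator X (tau a))
    & forall a, (forall Q, exists l, tau (a ** iota Q) = l%:M) -> a = 0].

(** * Operators on [B] with scalar values *)

Section MatrixOperators.
Variables (k : comNzRingType) (B : naAlgType k) (hZ : regular_center B).
Variables (F : fieldType) (A : naAlgType F) (n : nat).
Variables (iota : {linear 'M[F]_n -> A}) (tau : {linear A -> 'M[F]_n}).
Hypothesis iotaM : {morph iota : X Y / X *m Y >-> X ** Y}.
Hypothesis iota1l : forall a, iota 1%:M ** a = a.
Hypothesis iota1r : forall a, a ** iota 1%:M = a.
Hypothesis iota_tau : forall X a,
  commutator (iota X) a = iota (mx_commutator X (tau a)).
Hypothesis tau_nonscalar : forall a,
  (forall Q, exists l, tau (a ** iota Q) = l%:M) -> a = 0.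
Variables (j : {additive B -> A}) (c : F) (b : 'I_n -> 'I_n -> B).
Hypothesis j_inj : injective j.
Hypothesis jM : {morph j : x y / x ** y}.
Hypothesis c_neq0 : c != 0.
Hypothesis jb : forall s t, j (b s t) = c *: iota (delta_mx s t).

(* The sum over i of e_is Y e_ti is the scalar Y_st: for b_st = e_st this
   operator reads off the (s,t) entry of [e_p1p2, tau (x e_q1q2)]. *)
Definition mx_operator (s t p1 p2 q1 q2 : 'I_n) (x : B) : B :=
  \sum_i b i s ** (commutator (b p1 p2) (x ** b q1 q2) ** b t i).

(** Each of the four factors [b] contributes one [c]. The commutator lies in the image of [iota], so
    the sum can be computed in the matrix algebra. *)
Lemma mx_operatorE s t p1 p2 q1 q2 x :
  j (mx_operator s t p1 p2 q1 q2 x) =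
  c ^+ 4 *: iota (mx_commutator (delta_mx p1 p2)
                    (tau (j x ** iota (delta_mx q1 q2))) s t)%:M.
Proof.
rewrite /mx_operator raddf_sum /=.
rewrite -(sum_delta_sandwich _ s t) linear_sum scaler_sumr.
apply: eq_bigr => i _; rewrite !jM /commutator raddfB /= !jM !jb.
rewrite !(namulZl, namulZr) !scalerA -scalerBr -/(commutator _ _) iota_tau.
rewrite namulZl namulZr scalerA -!iotaM; congr (_ *: _).
by rewrite !exprS expr0 mulr1 !mulrA.
Qed.

Lemma scalar_central (a : F) : a *: iota 1%:M \in center A.
Proof.
apply/centerP; split=> *;
  by rewrite ?(namulZl, namulZr, iota1l, iota1r).
Qed.

Lemma center_of_image x : j x \in center A -> x \in center B.
Proof.
case/centerP=> jC jA jCA; apply/centerP; split=> *; apply: j_inj;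
  by rewrite !jM.
Qed.

Lemma embeds_of_matrix_image : embeds_in_fg_center_module B.
Proof.
pose T (p : 'I_n * 'I_n * ('I_n * 'I_n) * ('I_n * 'I_n)) :=
  mx_operator p.1.1.1 p.1.1.2 p.1.2.1 p.1.2.2 p.2.1 p.2.2.
apply: (embeds_of_center_maps hZ (T := T)).
- move=> p a x y; rewrite /T /mx_operator scaler_sumr -big_split /=.
  apply: eq_bigr => i _; rewrite /commutator.
  rewrite !(namulDl, namulDr, namulNl, namulNr, namulZl, namulZr).
  by rewrite scalerDr scalerN opprD addrACA.
- move=> p z x Zz; rewrite /T /mx_operator.
  rewrite (big_morph (namul z) (namulDr z) (namul0 z)).
  apply: eq_bigr => i _; rewrite /commutator (centralA Zz) (centralCA Zz).
  by rewrite (centralA Zz) -namulNr -namulDr (centralA Zz) (centralCA Zz).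
(* Scalar multiples of the identity [iota 1%:M] are central in [A], and centrality pulls back along
   the injective [j]. *)
- move=> p x; apply: center_of_image; rewrite mx_operatorE.
  by rewrite -scalemx1 linearZ scalerA scalar_central.
move=> x Tx0; apply: j_inj; rewrite raddf0.
(* If the identity of [A] vanishes, then [A] is zero. *)
have [one0|one_neq0] := eqVneq (iota 1%:M) 0.
  by rewrite -[j x]iota1l one0 na0mul.
apply: tau_nonscalar => Q; apply: scalar_of_commutator0 => p1 p2.
(* The condition is linear in [Q], so matrix units suffice; for them the operators read off every
   entry of the commutator. *)
rewrite [Q]matrix_sum_delta.
pose P X := mx_commutator (delta_mx p1 p2) (tau (j x ** iota X)) = 0.
have P0 : P 0 by rewrite /P linear0 namul0 linear0 mx_commutator0.
have PD X Y : P X -> P Y -> P (X + Y).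
  move=> PX PY; rewrite /P linearD namulDr linearD /mx_commutator mulmxDr.
  by rewrite mulmxDl opprD addrACA -![_ - _]/(mx_commutator _ _) PX PY addr0.
apply: (big_ind P) => // q1 _; apply: (big_ind P) => // q2 _.
rewrite /P linearZ namulZr linearZ /mx_commutator -scalemxAl -scalemxAr.
rewrite -scalerBr -/(mx_commutator _ _); set Y := mx_commutator _ _.
suff -> : Y = 0 by rewrite scaler0.
apply/matrixP=> s t; have /(congr1 j) := Tx0 (s, t, (p1, p2), (q1, q2)).
rewrite mx_operatorE raddf0 -/Y -scalemx1 linearZ => /eqP.
rewrite !scaler_eq0 expf_eq0 /= (negPf c_neq0) (negPf one_neq0) orbF => /eqP->.
by rewrite mxE.
Qed.

End MatrixOperators.

(** * Common denominators and the copy of [B] in its central fractions *)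

Section Fractions.
Variables (k : comNzRingType) (B : naAlgType k) (hZ : regular_center B).

Lemma common_denominator (I : finType) (q : I -> central_fractions hZ) :
  exists (x : denominator B) (b : I -> B), forall i, q i = cfrac hZ (b i) x.
Proof.
have [x xP] : exists x : denominator B, forall i, i \in enum I ->
    exists b, q i = cfrac hZ b x.
  elim: (enum I) => [|i s [x xs]]; first by exists (den1 hZ).
  (* The product of all denominators serves; numerators are rescaled at each step. *)
  have [a [y qi]] := fracP (q i); exists (den_mul hZ x y) => i'.
  rewrite inE => /predU1P[->|/xs[b ->]].
    exists (x ** a); rewrite qi; apply/frac_eqP => /=.
    by rewrite denA denCA.
  by exists (y ** b); apply/frac_eqP; rewrite /= denA.
have /choice[b bP] i : exists b, q i = cfrac hZ b x.
  by apply: xP; rewrite mem_enum.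
by exists x, b.
Qed.

Implicit Type x : denominator B.

Definition to_frac x (y : B) : central_fractions hZ := cfrac hZ (x ** y) x.

Lemma to_frac_inj x : injective (to_frac x).
Proof. by move=> y z /frac_eqP/den_inj-/(_ hZ)/den_inj-/(_ hZ). Qed.

Lemma to_fracB x : {morph to_frac x : y z / y - z}.
Proof.
move=> y z; rewrite /to_frac frac_oprE frac_addrE; apply/frac_eqP => /=.
by rewrite -namulDr -namulNr -namulDr denA.
Qed.

Lemma to_fracM x : {morph to_frac x : y z / y ** z}.
Proof.
move=> y z; rewrite [RHS]frac_mulE; apply/frac_eqP => /=.
by rewrite !denA denCA.
Qed.

(** The denominator [x] itself as an element of the field, written x x / x. *)
Definition cf_den x : center_field hZ :=
  CenterField (center_frac_subproof hZ x (centerM (denZ x) (denZ x))).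

Lemma cf_den_neq0 x : cf_den x != 0.
Proof.
apply/eqP => /(congr1 val) /=; rewrite -(frac0E hZ x) => /frac_eqP.
rewrite namul0 => /eqP; apply/negP.
have /andP[_ xx0] := den_mul_subproof hZ x x.
apply: contra xx0 => /eqP xx0; apply/eqP.
by apply: (den_inj hZ (x := x)); rewrite xx0 namul0.
Qed.

Lemma to_frac_num x y : to_frac x y = cf_den x *: cfrac hZ y x.
Proof.
rewrite [RHS]frac_mulE; apply/frac_eqP => /=.
by rewrite !denA.
Qed.

(** With a common denominator x for the preimages of the matrix units, their numerators are elements
    of [B] that map to x e_st, so c is x viewed in the field. *)
Lemma embeds_of_matrix_order (A : naAlgType (center_field hZ)) (n : nat) :
  matrix_controlled n A ->
  central_order_in hZ A -> embeds_in_fg_center_module B.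
Proof.
case=> iota [tau [iotaM iota1l iota1r iota_tau tau_nonscalar]] [f [f_bij fM]].
have [x [b bE]] : exists (x : denominator B) b, forall i : 'I_n * 'I_n,
    exists2 q, f q = iota (delta_mx i.1 i.2) & q = cfrac hZ (b i) x.
  have [g fK gK] := f_bij.
  have [x [b bE]] := common_denominator
    (fun i : 'I_n * 'I_n => g (iota (delta_mx i.1 i.2))).
  exists x, b => i; exists (g (iota (delta_mx i.1 i.2))) => //; exact: gK.
have j_zmod : zmod_morphism (fun y => f (to_frac x y)).
  by move=> y z; rewrite to_fracB raddfB.
pose j := HB.pack_for {additive B -> A} (fun y => f (to_frac x y))
  (GRing.isZmodMorphism.Build B A (fun y => f (to_frac x y)) j_zmod).
apply: (@embeds_of_matrix_image k B hZ _ A n iota tau iotaM iota1l iota1r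
          iota_tau tau_nonscalar j (cf_den x) (fun s t => b (s, t))).
- exact: inj_comp (bij_inj f_bij) (@to_frac_inj x).
- by move=> y z; rewrite /= to_fracM fM.
- exact: cf_den_neq0.
by move=> s t; rewrite /= to_frac_num linearZ /=; have [q <- ->] := bE (s, t).
Qed.

End Fractions.

(** * Matrices X for which all X Q + R(v Q) are scalar *)

Section Twist.
Variables (F : fieldType) (n : nat) (R : {linear 'rV[F]_n -> 'M[F]_n}).
Hypothesis n_gt1 : (1 < n)%N.
Hypothesis R_twisted :
  forall c : 'cV[F]_n, ~ forall w, exists l, R w = l%:M - c *m w.

Lemma twist_nonscalar (v : 'rV[F]_n) (X : 'M[F]_n) :
  (forall Q : 'M[F]_n, exists l, X *m Q + R (v *m Q) = l%:M) -> v = 0 /\ X = 0.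
Proof.
move=> sc; have [v0|] := eqVneq v 0.
  split=> //; apply/matrixP=> i j; rewrite mxE.
  (* X_ij is the (i,d) entry of X e_jd, which is off the diagonal of a scalar matrix once d differs
     from i. *)
  have [d di] : exists d, d != i.
    have [i0|ni0] := eqVneq (i : nat) 0%N.
      by exists (Ordinal n_gt1); rewrite -val_eqE /= i0.
    by exists (Ordinal (ltnW n_gt1)); rewrite -val_eqE /= eq_sym.
  have [l] := sc (delta_mx j d); rewrite v0 mul0mx linear0 addr0.
  move=> /matrixP/(_ i d); rewrite !mxE eq_sym (negPf di) mulr0n.
  rewrite (bigD1 j) //= big1 => [|m mj]; rewrite !mxE ?(negPf mj) ?mulr0 //.
  by rewrite !eqxx mulr1 addr0.
(* As v y = 1, evaluating at Q = y w gives R w = l - (X y) w. *)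
case/rV0Pn=> i vi; pose y : 'cV[F]_n := (v 0 i)^-1 *: delta_mx i 0.
have vy : v *m y = 1%:M.
  rewrite -scalemxAr -colE; apply/matrixP=> r s; rewrite !ord1 !mxE.
  by rewrite mulVf.
case: (R_twisted (c := X *m y)) => w; have [l] := sc (y *m w).
by rewrite !mulmxA vy mul1mx => lE; exists l; rewrite -lE [RHS]addrC addKr.
Qed.

End Twist.

(** * The matrix RS-algebra *)

Section MatrixRS.
Variables (F : fieldType) (n : nat).
Local Notation A := (matrixRS F n).

Definition matrixRS_in (X : 'M[F]_n) : A := (0, X).
Definition matrixRS_out (a : A) : 'M[F]_n := a.2 + diag_mx a.1.

Fact matrixRS_in_linear : linear matrixRS_in.
Proof. by move=> c X Y; congr (_, _); rewrite /= ?scaler0 ?addr0. Qed.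
HB.instance Definition _ :=
  GRing.isLinear.Build F 'M[F]_n A *:%R matrixRS_in matrixRS_in_linear.

Fact matrixRS_out_linear : linear matrixRS_out.
Proof.
by move=> c [v X] [w Y]; rewrite /matrixRS_out /= linearP addr_lincomb.
Qed.
HB.instance Definition _ :=
  GRing.isLinear.Build F A 'M[F]_n *:%R matrixRS_out matrixRS_out_linear.

Lemma matrixRS_in_mul X (a : A) : matrixRS_in X ** a =
  (a.1 *m X, X *m a.2 + mx_commutator X (diag_mx a.1)).
Proof.
case: a => w Y; congr (_, _) => /=; rewrite mul0mx addr0.
by apply/rowP=> i; rewrite !mxE mul0r add0r.
Qed.

Lemma matrixRS_mul_in (a : A) X :
  a ** matrixRS_in X = (a.1 *m X, a.2 *m X).
Proof.
case: a => w Y; congr (_, _) => /=.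
  by apply/rowP=> i; rewrite mul0mx addr0 !mxE mulr0 add0r.
by rewrite linear0 mx_commutator0 addr0.
Qed.

Lemma matrixRS_commutator X (a : A) :
  commutator (matrixRS_in X) a = matrixRS_in (mx_commutator X (matrixRS_out a)).
Proof.
rewrite /commutator matrixRS_in_mul matrixRS_mul_in mx_commutatorDr.
by congr (_, _); rewrite /= subrr.
Qed.

(** For w = e_j the (i,j) entry gives c_i = 0. For w = e_i the (j,j) entry gives l = 0, and then the
    (i,i) entry reads 1 = 0. *)
Lemma diag_mx_twisted (c : 'cV[F]_n) : (1 < n)%N ->
  ~ forall w, exists l, diag_mx w = l%:M - c *m w.
Proof.
move=> n_gt1 cP; pose i := Ordinal n_gt1; pose j := Ordinal (ltnW n_gt1).
have [l /matrixP lP] := cP (delta_mx 0 i).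
have [m /matrixP mP] := cP (delta_mx 0 j).
have := lP i i; have := lP j j; have := mP i j.
rewrite !mxE !big_ord1 !mxE /= !mulr1 !mulr0 !mulr0n !mulr1n sub0r subr0.
move=> /esym/eqP; rewrite oppr_eq0 => /eqP-> <-.
by rewrite subr0 => /eqP; rewrite oner_eq0.
Qed.

Lemma matrixRS_controlled : (1 < n)%N -> matrix_controlled n A.
Proof.
move=> n_gt1; exists matrixRS_in, matrixRS_out; split.
- by move=> X Y; rewrite matrixRS_mul_in /= mul0mx.
- by case=> v X; rewrite matrixRS_in_mul mx_commutator1 /= mulmx1 mul1mx addr0.
- by case=> v X; rewrite matrixRS_mul_in /= !mulmx1.
- exact: matrixRS_commutator.
case=> v X sc.
have [c|Q|-> ->//] :=
    twist_nonscalar (R := @diag_mx F n) n_gt1 _ (v := v) (X := X).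
  exact: diag_mx_twisted.
by have := sc Q; rewrite matrixRS_mul_in.
Qed.

End MatrixRS.

(** * The algebras V_2 + M_2(F) *)

Section AlgebraVM.
Variables (F : fieldType).
Variables (bul : {bilinear 'rV[F]_2 -> 'rV[F]_2 -> 'rV[F]_2}) (C : 'M[F]_2).
Local Notation A := (algebraVM bul C).

HB.instance Definition _ :=
  GRing.isLinear.Build F 'rV[F]_2 'M[F]_2 *:%R (bullet_rmx bul)
    (bullet_rmx_linear bul).

Lemma row_pi0 : row_pi 0 = 0 :> 'M[F]_2.
Proof. by apply/matrixP=> i j; rewrite !mxE. Qed.

Lemma row_psi0 : row_psi C 0 = 0.
Proof. by apply/matrixP=> i j; rewrite !mxE mul0r. Qed.

Definition algebraVM_in (X : 'M[F]_2) : A := (0, X).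
Definition algebraVM_out (a : A) : 'M[F]_2 := a.2 + bullet_rmx bul a.1.

Fact algebraVM_in_linear : linear algebraVM_in.
Proof. by move=> c X Y; congr (_, _); rewrite /= ?scaler0 ?addr0. Qed.
HB.instance Definition _ :=
  GRing.isLinear.Build F 'M[F]_2 A *:%R algebraVM_in algebraVM_in_linear.

Fact algebraVM_out_linear : linear algebraVM_out.
Proof.
by move=> c [v X] [w Y]; rewrite /algebraVM_out /= linearP addr_lincomb.
Qed.
HB.instance Definition _ :=
  GRing.isLinear.Build F A 'M[F]_2 *:%R algebraVM_out algebraVM_out_linear.

(** The terms in [bul] and [row_psi] vanish when one factor has zero row part. *)
Lemma algebraVM_in_mul X (a : A) : algebraVM_in X ** a =
  (a.1 *m X, X *m a.2 + mx_commutator X (bullet_rmx bul a.1)).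
Proof.
case: a => w Y; congr (_, _) => /=; first by rewrite linear0l mul0mx !add0r.
by rewrite row_pi0 mulmx0 addr0.
Qed.

Lemma algebraVM_mul_in (a : A) X :
  a ** algebraVM_in X = (a.1 *m X, a.2 *m X).
Proof.
case: a => w Y; congr (_, _) => /=.
  by rewrite linear0r mul0mx addr0 add0r.
rewrite (linear0 (bullet_rmx bul)) mx_commutator0 addr0.
by rewrite row_psi0 mul0mx addr0.
Qed.

Lemma algebraVM_commutator X (a : A) :
  commutator (algebraVM_in X) a =
  algebraVM_in (mx_commutator X (algebraVM_out a)).
Proof.
rewrite /commutator algebraVM_in_mul algebraVM_mul_in mx_commutatorDr.
by congr (_, _); rewrite /= subrr.
Qed.

Lemma bullet_rmx_twisted (c : 'cV[F]_2) (i : 'I_2) :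
    ~ bullet_closed bul (coord_line F i) ->
  ~ forall w, exists l, bullet_rmx bul w = l%:M - c *m w.
Proof.
move=> ncl cP; apply: ncl => u u' /vlineP[a ->] /vlineP[a' ->].
rewrite linearZl linearZr /= !memvZ //; apply/vlineP.
(* For w = e_i, row i of the matrix of right multiplication by w is the product of e_i with itself,
   while row i of l - c w is (l - c_i) e_i. *)
have [l lP] := cP (delta_mx 0 i).
have -> : bul (delta_mx 0 i) (delta_mx 0 i) = (l - c i 0) *: delta_mx 0 i.
  apply/rowP=> j; have /matrixP/(_ i j) := lP.
  rewrite !mxE big_ord1 !mxE => ->.
  by rewrite (eq_sym i) !eqxx /= mulrBl !mulr_natr.
by exists (l - c i 0).
Qed.

Lemma algebraVM_controlled (i : 'I_2) :
  ~ bullet_closed bul (coord_line F i) -> matrix_controlled 2 A.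
Proof.
move=> ncl; exists algebraVM_in, algebraVM_out; split.
- by move=> X Y; rewrite algebraVM_mul_in /= mul0mx.
- by case=> v X; rewrite algebraVM_in_mul mx_commutator1 /= mulmx1 mul1mx addr0.
- by case=> v X; rewrite algebraVM_mul_in /= !mulmx1.
- exact: algebraVM_commutator.
case=> v X sc.
have [c|Q|-> ->//] :=
    twist_nonscalar (R := bullet_rmx bul) isT _ (v := v) (X := X).
  exact: (bullet_rmx_twisted ncl).
by have := sc Q; rewrite algebraVM_mul_in.
Qed.

End AlgebraVM.

Theorem theorem1 (k : comNzRingType) (B : naAlgType k)
    (hRS : right_symmetric B) (hZ : regular_center B) :
  (exists2 n : nat, (2 <= n)%N &
     central_order_in hZ (matrixRS (center_field hZ) n))
  \/
  (exists (bul : {bilinear 'rV[center_field hZ]_2 -> 'rV[center_field hZ]_2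
                           -> 'rV[center_field hZ]_2})
          (C : 'M[center_field hZ]_2),
     [/\ ~ bullet_closed bul (coord_line (center_field hZ) 0),
         ~ bullet_closed bul (coord_line (center_field hZ) 1)
       & central_order_in hZ (algebraVM bul C)]) ->
  embeds_in_fg_center_module B.
Proof.
case=> [[n n_gt1]|[bul [C [ncl _]]]].
  by apply: embeds_of_matrix_order; apply: matrixRS_controlled.
by apply: embeds_of_matrix_order; apply: algebraVM_controlled ncl.
Qed.
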